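(* For $i=1,2$ let $\mathcal{H}_i\subseteq\mathcal{K}_i$ be complex Hilbert spaces, let $T_i\in\mathcal{B}(\mathcal{H}_i)$ be a contraction and let $W_i\in\mathcal{B}(\mathcal{K}_i)$ be a co-isometric extension of $T_i$. Let $X\in\mathcal{B}(\mathcal{H}_1,\mathcal{H}_2)$. Suppose $Q\in\mathcal{B}(\mathcal{H}_1)$ and $\overline{Q}\in\mathcal{B}(\mathcal{K}_1)$ are contractions with $\mathcal{H}_1$ reducing $\overline{Q}$ and $\overline{Q}|_{\mathcal{H}_1}=Q$. (i) If $XT_1Q=T_2X$, then there exists an extension $Y\in\mathcal{B}(\mathcal{K}_1,\mathcal{K}_2)$ of $X$ such that $YW_1\overline{Q}=W_2Y$. (ii) If $XQT_1=T_2X$, then there exists an extension $Y\in\mathcal{B}(\mathcal{K}_1,\mathcal{K}_2)$ of $X$ such that $Y\overline{Q}W_1=W_2Y$. Suppose instead $Q\in\mathcal{B}(\mathcal{H}_2)$ and $\overline{Q}\in\mathcal{B}(\mathcal{K}_2)$ are unitaries with $\mathcal{H}_2$ reducing $\overline{Q}$ and $\overline{Q}|_{\mathcal{H}_2}=Q$. (iii) If $QXT_1=T_2X$, then there exists an extension $Y\in\mathcal{B}(\mathcal{K}_1,\mathcal{K}_2)$ of $X$ such that $\overline{Q}YW_1=W_2Y$. In all cases $T_2^nX=P_{\mathcal{H}_2}W_2^nY|_{\mathcal{H}_1}$ and $XT_1^n=P_{\mathcal{H}_2}YW_1^n|_{\mathcal{H}_1}$ for all integers $n\geq 0$, and $Y$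 can be chosen such that $\|Y\|=\|X\|$.
   Context: For Hilbert spaces $\mathcal{H}_1\subseteq\mathcal{K}_1$, $\mathcal{H}_2\subseteq\mathcal{K}_2$, $S\in\mathcal{B}(\mathcal{K}_1,\mathcal{K}_2)$ is an extension of $T\in\mathcal{B}(\mathcal{H}_1,\mathcal{H}_2)$ if $Sh=Th$ for all $h\in\mathcal{H}_1$. A co-isometric extension of $T_i\in\mathcal{B}(\mathcal{H}_i)$ is an extension $W_i\in\mathcal{B}(\mathcal{K}_i)$ with $W_iW_i^*=I$. $P_{\mathcal{H}_2}$ is the orthogonal projection onto $\mathcal{H}_2$. *)

(* Defs.v *)
From HB Require Import structures.
From mathcomp Require Import all_boot all_order all_algebra.
From mathcomp Require Import complex.
From mathcomp Require Import boolp classical_sets reals.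
Set Implicit Arguments. Unset Strict Implicit. Unset Printing Implicit Defensive.
Import Order.TTheory GRing.Theory Num.Theory.
Local Open Scope ring_scope.
Local Open Scope classical_set_scope.

Section Hilbert.
Variable R : realType.
Local Notation C := R[i].
Variable V : lmodType C.
Variable ip : V -> V -> C.

Definition hnorm (x : V) : R := Num.sqrt (complex.Re (ip x x)).

Definition is_inner_product : Prop :=
  [/\ (forall (a : C) (x y z : V), ip (a *: x + y) z = a * ip x z + ip y z),
      (forall x y : V, ip y x = conjc (ip x y)),
      (forall x : V, 0 <= ip x x) &
      (forall x : V, ip x x = 0 -> x = 0)].

Definition cauchy_seq (u : nat -> V) : Prop :=
  forall e : R, 0 < e -> exists N : nat, forall m n : nat,
    (N <= m)%N -> (N <= n)%N -> hnorm (u m - u n) < e.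

Definition converges_to (u : nat -> V) (l : V) : Prop :=
  forall e : R, 0 < e -> exists N : nat, forall n : nat,
    (N <= n)%N -> hnorm (u n - l) < e.

Definition is_hilbert : Prop :=
  is_inner_product /\
  forall u : nat -> V, cauchy_seq u -> exists l : V, converges_to u l.

(* H is a closed linear subspace (hence itself a Hilbert space) *)
Definition closed_subspace (H : set V) : Prop :=
  [/\ H 0,
      (forall (a : C) (x y : V), H x -> H y -> H (a *: x + y)) &
      (forall (u : nat -> V) (l : V), (forall n, H (u n)) -> converges_to u l -> H l)].

Definition orth (H : set V) : set V := [set x | forall h, H h -> ip x h = 0].

Definition is_orth_proj (H : set V) (v p : V) : Prop :=
  H p /\ (forall h, H h -> ip (v - p) h = 0).

Definition proj (H : set V) (v : V) : V := xget 0 [set p | is_orth_proj H v p].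

End Hilbert.

Section Operators.
Variable R : realType.
Local Notation C := R[i].
Variables (V1 V2 : lmodType C) (ip1 : V1 -> V1 -> C) (ip2 : V2 -> V2 -> C).

Definition maps_into (D : set V1) (E : set V2) (f : V1 -> V2) : Prop :=
  forall x, D x -> E (f x).

Definition linear_on (D : set V1) (f : V1 -> V2) : Prop :=
  forall (a : C) (x y : V1), D x -> D y -> f (a *: x + y) = a *: f x + f y.

Definition bounded_on (D : set V1) (f : V1 -> V2) : Prop :=
  exists M : R, forall x, D x -> hnorm ip2 (f x) <= M * hnorm ip1 x.

(* f is an element of B(D, E), D and E subspaces; f is only relevant on D *)
Definition bop_on (D : set V1) (E : set V2) (f : V1 -> V2) : Prop :=
  [/\ maps_into D E f, linear_on D f & bounded_on D f].

Definition opnorm (D : set V1) (f : V1 -> V2) : R :=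
  sup [set hnorm ip2 (f x) | x in [set x | D x /\ hnorm ip1 x <= 1]].

Definition adjoint_on (D : set V1) (E : set V2) (f : V1 -> V2) (g : V2 -> V1) : Prop :=
  (forall y, E y -> D (g y)) /\
  forall x y, D x -> E y -> ip2 (f x) y = ip1 x (g y).

Definition extends (H : set V1) (S T : V1 -> V2) : Prop :=
  forall h, H h -> S h = T h.
End Operators.

Section Endo.
Variable R : realType.
Local Notation C := R[i].
Variables (V : lmodType C) (ip : V -> V -> C).

Definition contraction_on (H : set V) (T : V -> V) : Prop :=
  bop_on ip ip H H T /\ forall h, H h -> hnorm ip (T h) <= hnorm ip h.

Definition coisometry (W : V -> V) : Prop :=
  bop_on ip ip setT setT W /\
  exists Ws : V -> V, bop_on ip ip setT setT Ws /\
    adjoint_on ip ip setT setT W Ws /\ forall y, W (Ws y) = y.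

Definition unitary_on (H : set V) (Q : V -> V) : Prop :=
  bop_on ip ip H H Q /\
  exists Qs : V -> V, bop_on ip ip H H Qs /\ adjoint_on ip ip H H Q Qs /\
    (forall h, H h -> Q (Qs h) = h) /\ (forall h, H h -> Qs (Q h) = h).

Definition reduces (H : set V) (Qb : V -> V) : Prop :=
  maps_into H H Qb /\ maps_into (orth ip H) (orth ip H) Qb.
End Endo.

Definition good_extension (R : realType) (V1 V2 : lmodType R[i])
  (ip1 : V1 -> V1 -> R[i]) (ip2 : V2 -> V2 -> R[i]) (H1 : set V1) (H2 : set V2)
  (T1 W1 : V1 -> V1) (T2 W2 : V2 -> V2) (X Y : V1 -> V2) : Prop :=
  [/\ bop_on ip1 ip2 setT setT Y,
      extends H1 Y X,
      (forall (n : nat) h, H1 h ->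
         iter n T2 (X h) = proj ip2 H2 (iter n W2 (Y h))),
      (forall (n : nat) h, H1 h ->
         X (iter n T1 h) = proj ip2 H2 (Y (iter n W1 h))) &
      opnorm ip1 ip2 setT Y = opnorm ip1 ip2 H1 X].

(* Main.v *)
(** In all three cases the problem is to extend [X], defined on the subspace [H1],
    to [Y] with [Y A = W Y] and the same norm, where [A] is a contraction of [K1]
    leaving [H1] invariant and [W] is a co-isometry of [K2]: take [A = W1 Qb],
    [A = Qb W1], or [A = W1] with [W = Qb^* W2].  The space [H2] plays no role.

    Given any extension [Y] of [X] with [|Y| <= |X|], there is another one, [Y'],
    with [W Y' = Y A].  Iterating gives extensions [Y_n] with
    [W Y_(n+1) = Y_n A], and a weak Banach limit of [Y_n] intertwines [A] and [W]
    because a Banach limit is shift invariant.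

    Only real parts of inner products are used; complex linearity is recovered
    from [Re <a x, y> = Re <x, a^* y>]. *)

Require Import Defs.
From HB Require Import structures.
From mathcomp Require Import all_boot all_order all_algebra.
From mathcomp Require Import complex.
From mathcomp Require Import boolp classical_sets reals.
From mathcomp Require Import filter topology normedtype sequences.
From mathcomp Require Import ring lra.
Set Implicit Arguments. Unset Strict Implicit. Unset Printing Implicit Defensive.
Import Order.TTheory GRing.Theory Num.Theory.
Import numFieldNormedType.Exports.
Local Open Scope ring_scope.
Local Open Scope classical_set_scope.

(** A discriminant bound: the quadratic in [t] peaks at [t = D / Q] with value [D ^+ 2 / Q]. *)
Lemma sqr_le_of_quadratic (F : realFieldType) (D Q e : F) : 0 <= e -> 0 <= Q ->
  (forall t, 2 * t * D - t ^+ 2 * Q <= e) -> D ^+ 2 <= e * Q.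
Proof.
move=> e0; rewrite le_eqVlt => /orP[/eqP <-|Q0] line.
  have [->|D0] := eqVneq D 0; first by rewrite expr0n mulr0.
  (* With [Q = 0] the left side is linear in [t]; here it equals [2 * (e + 1)], which exceeds
     [e]. *)
  have := line ((e + 1) / D); rewrite mulr0 subr0 -mulrA divfK //; lra.
have := line (D / Q).
have -> : 2 * (D / Q) * D - (D / Q) ^+ 2 * Q = D ^+ 2 / Q.
  by field; rewrite gt_eqF.
by rewrite ler_pdivrMr.
Qed.

(** * Calculus of positive semidefinite forms *)

Section SemiInnerProduct.
Variables (R : realType) (V : lmodType R[i]).

(* The real part of a positive semidefinite sesquilinear form. *)
Record semi_ip (q : V -> V -> R) : Prop := SemiIp {
  sipD : forall x y z, q (x + y) z = q x z + q y z;
  sipC : forall x y, q x y = q y x;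
  sipZ : forall (a : R[i]) x y, q (a *: x) y = q x (conjc a *: y);
  sipR : forall (r : R) x y, q ((r%:C)%C *: x) y = r * q x y;
  sip_ge0 : forall x, 0 <= q x x }.

Definition subspace (H : set V) : Prop :=
  H 0 /\ forall (a : R[i]) x y, H x -> H y -> H (a *: x + y).

Definition sqnormc (a : R[i]) : R := complex.Re (conjc a * a).

Lemma conjcM_sqnormc (a : R[i]) : conjc a * a = ((sqnormc a)%:C)%C.
Proof.
case: a => a b; rewrite /sqnormc /=; apply/eqP.
by rewrite eq_complex /= !eqxx /=; apply/eqP; ring.
Qed.

Lemma sqnormc_ge0 (a : R[i]) : 0 <= sqnormc a.
Proof. by case: a => a b; rewrite /sqnormc /=; nra. Qed.

Section Form.
Variables (q : V -> V -> R) (qP : semi_ip q).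

Lemma sipDr x y z : q x (y + z) = q x y + q x z.
Proof. by rewrite sipC // sipD // !(sipC qP _ x). Qed.

Lemma sipRr (r : R) x y : q x ((r%:C)%C *: y) = r * q x y.
Proof. by rewrite sipC // sipR // sipC. Qed.

Lemma sipN x y : q (- x) y = - q x y.
Proof.
have -> : - x = ((- 1 : R)%:C)%C *: x by rewrite rmorphN1 scaleN1r.
by rewrite sipR // mulN1r.
Qed.

Lemma sipNr x y : q x (- y) = - q x y.
Proof. by rewrite sipC // sipN sipC. Qed.

Lemma sipB x y z : q (x - y) z = q x z - q y z.
Proof. by rewrite sipD // sipN. Qed.

Lemma sipBr x y z : q x (y - z) = q x y - q x z.
Proof. by rewrite sipDr sipNr. Qed.

Lemma sip0 x : q 0 x = 0.
Proof. by rewrite -(subrr 0) sipB subrr. Qed.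

Lemma sipZZ a x : q (a *: x) (a *: x) = sqnormc a * q x x.
Proof. by rewrite sipZ // scalerA conjcM_sqnormc sipRr. Qed.

Lemma sip_sqrD x y : q (x + y) (x + y) = q x x + 2 * q x y + q y y.
Proof. rewrite sipD // !sipDr (sipC qP y x); lra. Qed.

Lemma sip_sqrB x y : q (x - y) (x - y) = q x x - 2 * q x y + q y y.
Proof. rewrite sipB // !sipBr (sipC qP y x); lra. Qed.

Lemma sip_sqrD_le2 x y : q (x + y) (x + y) <= 2 * (q x x + q y y).
Proof.
have := sip_ge0 qP (x - y); rewrite sip_sqrB sip_sqrD; lra.
Qed.

Lemma sip_AMGM x y : 2 * q x y <= q x x + q y y.
Proof. have := sip_ge0 qP (x - y); rewrite sip_sqrB; lra. Qed.

Lemma sip_CauchySchwarz x y : q x y ^+ 2 <= q x x * q y y.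
Proof.
apply: sqr_le_of_quadratic => [||t]; try exact: sip_ge0.
by have := sip_AMGM x ((t%:C)%C *: y); rewrite sipRr sipR // sipRr; lra.
Qed.

Lemma sip_norm_le x y (B : R) : q y y <= B -> `|q x y| <= q x x + B.
Proof.
move=> yB; have xx := sip_ge0 qP x; have yy := sip_ge0 qP y.
have := sip_AMGM x y; have := sip_AMGM (- x) y.
rewrite ?sipN ?sipNr opprK => h1 h2.
by rewrite ler_norml; apply/andP; split; lra.
Qed.

End Form.
End SemiInnerProduct.

(** * Approximate Riesz representation on a subspace *)

Section Riesz.
Variables (R : realType) (V : lmodType R[i]) (q : V -> V -> R).
Hypothesis qP : semi_ip q.
Variables (H : set V) (f : V -> R) (B : R).
Hypothesis subH : subspace H.
Hypothesis fD : forall x y, H x -> H y -> f (x + y) = f x + f y.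
Hypothesis fR : forall (r : R) x, H x -> f ((r%:C)%C *: x) = r * f x.
(** Boundedness of [f] without square roots: by scaling [x] it amounts to [f x ^+ 2 <= B * q x x],
    and it bounds [2 f - q] from above. *)
Hypothesis f_le : forall x, H x -> 2 * f x <= q x x + B.

(* A near maximiser h of 2 f - q nearly represents f, since the supremum is
   not exceeded along any line through h. *)
Lemma approx_riesz (e : R) : 0 < e ->
  exists2 h, H h & forall k, H k -> (f k - q h k) ^+ 2 <= e * q k k.
Proof.
move=> e0; case: subH => H0 HD.
pose S := [set 2 * f x - q x x | x in H].
have supS : has_sup S.
  split; first by exists (2 * f 0 - q 0 0), 0.
  by exists B => _ [x Hx <-]; have := f_le Hx; lra.
have [_ [h Hh <-] hS] := sup_adherent e0 supS.
exists h => // k Hk.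
have line t : 2 * t * (f k - q h k) - t ^+ 2 * q k k <= e.
  have Htk : H ((t%:C)%C *: k) by rewrite -[_ *: k]addr0; exact: HD.
  have : S (2 * f (h + (t%:C)%C *: k) - q (h + (t%:C)%C *: k) (h + (t%:C)%C *: k)).
    by exists (h + (t%:C)%C *: k) => //; rewrite addrC; exact: HD.
  move/(sup_upper_bound supS); rewrite sip_sqrD // fD // fR // sipRr // sipR // sipRr //.
  move: hS; set s := sup S; lra.
exact: sqr_le_of_quadratic (ltW e0) (sip_ge0 qP k) line.
Qed.

End Riesz.

(** * Banach limits *)

Section BanachLimit.
Variable R : realType.

Definition bounded_seq (u : nat -> R) : Prop := exists M : R, forall n, `|u n| <= M.

(** The values lie in a compact interval, so the image ultrafilter clusters somewhere, and an
    ultrafilter converges to each of its cluster points. *)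
Lemma ultrafilter_cvg (U : set_system nat) (u : nat -> R) :
  UltraFilter U -> bounded_seq u -> exists l : R, u @ U --> l.
Proof.
move=> UU [M uM]; have UP := @ultra_proper _ _ UU.
have UF : Filter U by exact: filter_filter.
have [|l [_ clu]] := @segment_compact R (- M) M (u @ U) _.
  apply: (@filterE _ U UF) => n; rewrite /= in_itv /= -ler_norml; exact: uM.
exists l => N Nl; have [//|UN] := in_ultra_setVsetC (u @^-1` N) UU.
by have [x [/= nNx Nx]] := clu (~` N) N UN Nl.
Qed.

Lemma bounded_arithmetic_mean (u : nat -> R) :
  bounded_seq u -> bounded_seq (arithmetic_mean u).
Proof.
move=> [M uM]; exists M => n; rewrite /arithmetic_mean /series /=.
rewrite normrM ger0_norm ?invr_ge0 // mulrC ler_pdivrMr ?ltr0Sn //.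
rewrite big_mkord; apply: le_trans (ler_norm_sum _ _ _) _.
rewrite mulr_natr -[n.+1 in leRHS]card_ord -sumr_const.
by apply: ler_sum => i _; exact: uM.
Qed.

(** The difference telescopes to [(u n.+1 - u 0) / n.+1]. This is the source of shift invariance. *)
Lemma arithmetic_mean_shift (u : nat -> R) : bounded_seq u ->
  arithmetic_mean (fun k => u k.+1) n - arithmetic_mean u n @[n --> \oo] --> (0 : R).
Proof.
move=> [M uM].
have -> : (fun n => arithmetic_mean (fun k => u k.+1) n - arithmetic_mean u n) =
          (fun n => (u n.+1 - u 0%N) * harmonic n).
  apply/funext => n; rewrite /arithmetic_mean /series /=.
  rewrite -mulrBr mulrC; congr (_ * _).
  rewrite -sumrB; exact: telescope_sumr.
apply/cvgr0Pnorm_le => e e0.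
have M0 : 0 <= M by apply: le_trans (uM 0%N).
have M1 : 0 < 2 * M + 1 by lra.
have := @cvg_harmonic R.
move/cvgr0Pnorm_le => /(_ (e / (2 * M + 1)) (divr_gt0 e0 M1)).
apply: filterS => n; rewrite normrM => hn.
have : `|u n.+1 - u 0%N| <= 2 * M + 1.
  by have := ler_normB (u n.+1) (u 0%N); have := uM n.+1; have := uM 0%N; lra.
move/(ler_pM (normr_ge0 _) (normr_ge0 _))/(_ hn).
by rewrite mulrCA divff ?gt_eqF // mulr1.
Qed.

(** [L] is the limit of the Cesaro means along an ultrafilter finer than [\oo]: the ultrafilter
    makes the limit exist, the averaging makes it shift invariant. *)
Lemma banach_limit : exists L : (nat -> R) -> R,
  [/\ forall u v, bounded_seq u -> bounded_seq v ->
        L (fun n => u n + v n) = L u + L v,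
      forall c u, bounded_seq u -> L (fun n => c * u n) = c * L u,
      forall u, bounded_seq u -> L (fun n => u n.+1) = L u &
      forall u c, bounded_seq u -> (forall n, u n <= c) -> L u <= c].
Proof.
have [U [UU ooU]] := @ultraFilterLemma nat \oo _.
have UP := @ultra_proper _ _ UU.
have UF : Filter U by exact: filter_filter.
(* The default [0] can only occur for unbounded [u], about which nothing is claimed. *)
pose L u := xget (0 : R) [set l | arithmetic_mean u @ U --> l].
have LP u : bounded_seq u -> arithmetic_mean u @ U --> L u.
  move=> bu; have [l ul] := ultrafilter_cvg UU (bounded_arithmetic_mean bu).
  exact: (@xgetPex _ 0 [set l | arithmetic_mean u @ U --> l] (ex_intro _ l ul)).
have LE u l : bounded_seq u -> arithmetic_mean u @ U --> l -> L u = l.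
  by move=> /LP h1 h2; apply: (cvg_unique _ h1 h2).
exists L; split.
- move=> u v bu bv; apply: LE.
    case: bu bv => [M uM] [N vN]; exists (M + N) => n.
    exact: le_trans (ler_normD _ _) (lerD (uM n) (vN n)).
  have -> : arithmetic_mean (fun n => u n + v n) =
            (fun n => arithmetic_mean u n + arithmetic_mean v n).
    by apply/funext => n; rewrite /arithmetic_mean /series /= big_split /= mulrDr.
  exact: cvgD (LP _ bu) (LP _ bv).
- move=> c u bu; apply: LE.
    case: bu => [M uM]; exists (`|c| * M) => n.
    by rewrite normrM ler_wpM2l.
  have -> : arithmetic_mean (fun n => c * u n) = (fun n => c * arithmetic_mean u n).
    apply/funext => n; rewrite /arithmetic_mean /series /= mulrCA; congr (_ * _).
    by rewrite mulr_sumr.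
  by apply: cvgM; [exact: cvg_cst | exact: LP].
- move=> u bu; apply: LE.
    by case: bu => [M uM]; exists M => n.
  have d0 : arithmetic_mean (fun k => u k.+1) n - arithmetic_mean u n @[n --> U] --> (0 : R).
    by apply: cvg_trans (arithmetic_mean_shift bu); exact: cvg_app.
  have -> : arithmetic_mean (fun k => u k.+1) = (fun n =>
      (arithmetic_mean (fun k => u k.+1) n - arithmetic_mean u n) + arithmetic_mean u n).
    by apply/funext => n; rewrite subrK.
  by rewrite -[L u]add0r; exact: cvgD d0 (LP u bu).
- move=> u c bu uc; apply: (cvgr_to_le (LP u bu)).
  apply: filterE => n; rewrite /arithmetic_mean /series /=.
  rewrite mulrC ler_pdivrMr ?ltr0Sn // big_mkord.
  rewrite mulr_natr -[n.+1 in leRHS]card_ord -sumr_const.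
  by apply: ler_sum => i _; exact: uc.
Qed.

End BanachLimit.

(** * Real parts of inner products *)

Section HilbertReal.
Variables (R : realType) (V : lmodType R[i]) (ip : V -> V -> R[i]).

Definition rip (x y : V) : R := complex.Re (ip x y).

Lemma ripP : is_inner_product ip -> semi_ip rip.
Proof.
case=> ipL ipC ip0 _.
have ip0l z : ip 0 z = 0.
  by have := ipL 1 0 0 z; rewrite scaler0 addr0 mul1r => /eqP; rewrite addrC -subr_eq subrr => /eqP.
have ipZ a x z : ip (a *: x) z = a * ip x z by rewrite -[a *: x]addr0 ipL ip0l addr0.
split; rewrite /rip.
- by move=> x y z; rewrite -[x]scale1r ipL mul1r scale1r raddfD.
- by move=> x y; rewrite ipC; case: (ip y x).
- move=> a x y; rewrite ipZ (ipC (conjc a *: y) x) ipZ (ipC x y); case: a (ip x y) => [a b] [c d] /=; ring.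
- by move=> r x y; rewrite ipZ; case: (ip x y) => c d /=; rewrite mul0r subr0.
- by move=> x; have := ip0 x; rewrite lecE => /andP[].
Qed.

(** The order on [R[i]] makes [0 <= ip x x] include a vanishing imaginary part, so the real part
    decides. *)
Lemma rip_eq0 x : is_inner_product ip -> rip x x <= 0 -> x = 0.
Proof.
move=> ipP xx; case: (ipP) => _ _ ip0 ipd; apply: ipd; have := ip0 x; rewrite lecE => /andP[/eqP /= im0 re0].
have re : complex.Re (ip x x) = 0 by apply/le_anti; rewrite re0 andbT; exact: xx.
by move: re im0; case: (ip x x) => a b /= -> ->.
Qed.

Lemma hnorm_ge0 x : 0 <= hnorm ip x.
Proof. exact: sqrtr_ge0. Qed.

Lemma hnormE x : is_inner_product ip -> hnorm ip x ^+ 2 = rip x x.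
Proof. by move=> ipP; rewrite sqr_sqrtr //; exact: (sip_ge0 (ripP ipP)). Qed.

Lemma hnorm_lt x (e : R) : is_inner_product ip -> 0 < e ->
  (hnorm ip x < e) = (rip x x < e ^+ 2).
Proof.
by move=> ipP e0; rewrite -hnormE // ltr_pXn2r // nnegrE ?hnorm_ge0 ?ltW.
Qed.

Lemma hnorm_le_rip (V' : lmodType R[i]) (ip' : V' -> V' -> R[i]) (x : V) (y : V') (M : R) :
  is_inner_product ip -> is_inner_product ip' -> 0 <= M ->
  (hnorm ip x <= M * hnorm ip' y) =
  (rip x x <= M ^+ 2 * complex.Re (ip' y y)).
Proof.
move=> ipP ipP' M0.
have h : 0 <= hnorm ip' y := sqrtr_ge0 _.
rewrite -(hnormE x) // -[complex.Re _]sqr_sqrtr; last first.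
  by case: ipP' => _ _ /(_ y); rewrite lecE => /andP[].
by rewrite -exprMn ler_pXn2r // nnegrE ?hnorm_ge0 // mulr_ge0.
Qed.

End HilbertReal.

(** * Extending a contraction from a subspace of a semi-inner product space *)

Section ContractionExtension.
Variables (R : realType) (V G : lmodType R[i]) (q : V -> V -> R).
Variable ip : G -> G -> R[i].
Hypothesis qP : semi_ip q.
Hypothesis hG : is_hilbert ip.
Local Notation r := (rip ip).
Variables (H : set V) (C : V -> G).
Hypothesis subH : subspace H.
Hypothesis C_lin : linear_on H C.
Hypothesis C_le : forall h, H h -> r (C h) (C h) <= q h h.

Let ipP : is_inner_product ip := hG.1.
Let rP : semi_ip r := ripP ipP.

Let HB h k : H h -> H k -> H (h - k).
Proof. by move=> Hh Hk; rewrite addrC -scaleN1r; apply: subH.2. Qed.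

Let CB h k : H h -> H k -> C (h - k) = C h - C k.
Proof. by move=> Hh Hk; rewrite addrC -scaleN1r C_lin // scaleN1r addrC. Qed.

(** Near representers [h n] of [f] form a [q]-Cauchy sequence. They may have no limit in [H], but
    [C] is contractive into a Hilbert space, so [C (h n)] converges; [y] is its limit. *)
Lemma riesz_image (f : V -> R) (B : R) :
  (forall x y, H x -> H y -> f (x + y) = f x + f y) ->
  (forall (c : R) x, H x -> f ((c%:C)%C *: x) = c * f x) ->
  (forall x, H x -> 2 * f x <= q x x + B) ->
  exists y, forall e : R, 0 < e -> exists h,
    [/\ H h, forall k, H k -> (f k - q h k) ^+ 2 <= e * q k k &
        r (y - C h) (y - C h) <= e].
Proof.
move=> fD fR f_le.
have /boolp.choice[h hP] : forall n : nat, exists h, H h /\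
    forall k, H k -> (f k - q h k) ^+ 2 <= n.+1%:R^-1 * q k k.
  move=> n; have n0 : 0 < n.+1%:R^-1 :> R by rewrite invr_gt0 ltr0Sn.
  by have [h Hh hk] := approx_riesz qP subH fD fR f_le n0; exists h.
have tail (e : R) : 0 < e -> exists N : nat, forall n, (N <= n)%N -> n.+1%:R^-1 <= e.
  move=> e0; have /cvgr0Pnorm_le/(_ e e0)[N _ HN] := @cvg_harmonic R.
  exists N => n Nn; have := HN n Nn; rewrite /= ger0_norm ?invr_ge0 //.
(* Both representation errors are tested on [d = h m - h n] itself: [q d d] is their difference and
   each has square at most [e * q d d]. *)
have dist : forall (m n : nat) (e : R), 0 <= e -> m.+1%:R^-1 <= e -> n.+1%:R^-1 <= e ->
    r (C (h m) - C (h n)) (C (h m) - C (h n)) <= 4 * e.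
  move=> m n e e0 me ne; have [Hm hm] := hP m; have [Hn hn] := hP n.
  rewrite -CB //; apply: le_trans (C_le (HB Hm Hn)) _.
  set d := h m - h n; have Hd : H d := HB Hm Hn.
  have dE : q d d = (f d - q (h n) d) - (f d - q (h m) d) by rewrite {1}/d sipB //; lra.
  have := hm d Hd; have := hn d Hd; have := sip_ge0 qP d.
  move: (q d d) (f d - q (h n) d) (f d - q (h m) d) dE => Q a b dE Q0 an bm.
  have ae : a ^+ 2 <= e * Q by apply: le_trans an _; exact: ler_wpM2r.
  have be : b ^+ 2 <= e * Q by apply: le_trans bm _; exact: ler_wpM2r.
  rewrite leNgt; apply/negP => Qe.
  have : Q * Q <= 4 * e * Q by rewrite {1 2}dE; nra.
  by rewrite ler_pM2r ?leNgt ?Qe //; apply: le_lt_trans Qe; lra.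
have [y yP] : exists l, converges_to ip (C \o h) l.
  apply: hG.2 => e e0; have [|N NP] := tail (e ^+ 2 / 8); first by rewrite divr_gt0 ?exprn_gt0.
  exists N => m n Nm Nn; rewrite hnorm_lt //=.
  have e20 : 0 < e ^+ 2 by rewrite exprn_gt0.
  have := dist m n (e ^+ 2 / 8) _ (NP _ Nm) (NP _ Nn); lra.
exists y => e e0; have [N NP] := tail e e0.
have [|N' NP'] := yP (Num.sqrt e); first by rewrite sqrtr_gt0.
pose n := maxn N N'; exists (h n); have [Hn hn] := hP n; split => //.
  move=> k Hk; apply: le_trans (hn k Hk) _.
  by apply: ler_wpM2r; [exact: sip_ge0 | exact/NP/leq_maxl].
have := NP' n (leq_maxr _ _); rewrite hnorm_lt ?sqrtr_gt0 // (sqr_sqrtr (ltW e0)) /= => /ltW.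
by rewrite -opprB sipN // sipNr // opprK.
Qed.

(* The graph of C composed with the q-orthogonal projection onto the
   q-completion of H. *)
Definition proj_graph (x : V) (y : G) : Prop := forall e : R, 0 < e ->
  exists h, [/\ H h, forall k, H k -> q (x - h) k ^+ 2 <= e * q k k &
                r (y - C h) (y - C h) <= e].

(** Near representers of the functional [q x] on [H] are near projections of [x]. *)
Lemma proj_graph_ex x : exists y, proj_graph x y.
Proof.
have [|||y yP] := @riesz_image (q x) (q x x).
- by move=> y z _ _; rewrite sipDr.
- by move=> c y _; rewrite sipRr.
- by move=> y _; have := sip_AMGM qP x y; lra.
exists y => e /yP[h [Hh hk hy]]; exists h; split => // k Hk.
by rewrite sipB //; exact: hk.
Qed.

Lemma proj_graph_lin (a : R[i]) x y x' y' : proj_graph x y -> proj_graph x' y' ->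
  proj_graph (a *: x + x') (a *: y + y').
Proof.
move=> xy xy' e e0; have a0 := sqnormc_ge0 a.
(* By [(b + c)^2 <= 2 b^2 + 2 c^2], errors [s] in both arguments combine to at most
   [2 (|a|^2 s + s)]. *)
have [s s0 sE] : exists2 s, 0 < s & 2 * (sqnormc a * s + s) = e.
  exists (e / (2 * (sqnormc a + 1))); first by rewrite divr_gt0 //; lra.
  by field; rewrite gt_eqF //; lra.
have [h [Hh hk hy]] := xy s s0; have [h' [Hh' hk' hy']] := xy' s s0.
have subE (U : lmodType R[i]) (u u' v v' : U) :
    a *: u + u' - (a *: v + v') = a *: (u - v) + (u' - v').
  by rewrite scalerBr opprD addrACA.
exists (a *: h + h'); split; first exact: subH.2.
- move=> k Hk; rewrite subE sipD // sipZ //.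
  have Hak : H (conjc a *: k) by rewrite -[_ *: k]addr0; apply: subH.2 => //; exact: subH.1.
  have := hk _ Hak; have := hk' _ Hk; rewrite sipZZ //.
  have -> : sqnormc (conjc a) = sqnormc a by rewrite /sqnormc conjcK mulrC.
  rewrite -sE; move: (q (x' - h') k) (q (x - h) _) => b c.
  have := sqr_ge0 (c - b); lra.
- rewrite C_lin // subE; apply: le_trans (sip_sqrD_le2 rP _ _) _.
  by rewrite sipZZ // -sE; nra.
Qed.

(** Up to small errors, [y] is [C h], [C] is contractive, and [x - h] is orthogonal to [h], so that
    [q h h <= q x x] by Pythagoras. *)
Lemma proj_graph_le x y : proj_graph x y -> r y y <= q x x.
Proof.
move=> xy; have x0 := sip_ge0 qP x; have y0 := sip_ge0 rP y.
(* The final errors are [d * r y y], [d * q x x] and at most [3 * d]; [K] does not depend on [d]. *)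
pose K := r y y + q x x + 3.
suff small (d : R) : 0 < d -> d < 1 / 4 -> r y y <= q x x + d * K.
  rewrite leNgt; apply/negP => lt_xy.
  (* For this [d] the error [d * K] is at most half of the gap, and [d < 1 / 4]. *)
  pose d := (r y y - q x x) / (2 * (K + r y y + 2)).
  have D0 : 0 < 2 * (K + r y y + 2) by rewrite /K; lra.
  have d0 : 0 < d by rewrite divr_gt0 // subr_gt0.
  have dE : d * (2 * (K + r y y + 2)) = r y y - q x x by rewrite /d divfK // gt_eqF.
  have d1 : d < 1 / 4 by rewrite /K in dE; nra.
  have := small d d0 d1; rewrite /K in dE *; nra.
move=> d0 d1; have [|h [Hh hk hy]] := xy (d ^+ 2); first by rewrite exprn_gt0.
have := hk h Hh; have := C_le Hh; have s0 := sip_ge0 qP h.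
have := sip_ge0 qP (x - h).
have qx : q x x = q (x - h) (x - h) + 2 * q (x - h) h + q h h.
  by rewrite -sip_sqrD // subrK.
have ry : r y y = r (y - C h) (y - C h) + 2 * r (y - C h) (C h) + r (C h) (C h).
  by rewrite -sip_sqrD // subrK.
(* The weight [d] balances the terms: [r (y - C h) (y - C h) <= d ^+ 2], so dividing by [d] leaves a
   cross term of order [d]. *)
have := sip_AMGM rP (y - C h) ((d%:C)%C *: C h).
rewrite sipRr // sipR // sipRr //.
move: (q (x - h) h) (q (x - h) (x - h)) (r (y - C h) (y - C h)) (r (y - C h) (C h)) hy qx ry.
move=> p w u v hy qx ry amgm w0 Cle ple.
have p_ge : - (2 * p) <= d + d * q h h.
  have : d * - (2 * p) <= d * (d + d * q h h) by have := sqr_ge0 (d + p); nra.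
  by rewrite ler_pM2l.
have v_le : 2 * v <= d + d * r (C h) (C h).
  have : d * (2 * v) <= d * (d + d * r (C h) (C h)) by nra.
  by rewrite ler_pM2l.
have s_le : q h h * (1 - d) <= q x x + d by lra.
have : r y y <= (1 + d) * q h h + d + d ^+ 2 by nra.
move=> y_le; have : (1 - d) * r y y <= (1 - d) * ((1 + d) * q h h + d + d ^+ 2).
  by rewrite ler_pM2l //; lra.
have : (1 + d) * (q h h * (1 - d)) <= (1 + d) * (q x x + d).
  by rewrite ler_pM2l //; lra.
have : 0 <= d ^+ 3 by rewrite exprn_ge0 // ltW.
have : d ^+ 2 <= d by rewrite expr2 ler_piMr ?ltW //; lra.
rewrite /K; lra.
Qed.

(** The graph is single valued: two values over [x] differ by a value over [0], which
    [proj_graph_le] forces to vanish. On [H] each [h] is its own projection. *)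
Lemma contraction_extension : exists C' : V -> G,
  [/\ linear_on setT C', extends H C' C & forall x, r (C' x) (C' x) <= q x x].
Proof.
have [C' C'P] := boolp.choice proj_graph_ex.
have uniq x y y' : proj_graph x y -> proj_graph x y' -> y = y'.
  move=> xy xy'; apply/eqP; rewrite -subr_eq0; apply/eqP/(rip_eq0 ipP).
  have := proj_graph_le (proj_graph_lin (-1) xy' xy).
  by rewrite !scaleN1r addNr sip0 // addrC.
exists C'; split.
- by move=> a x y _ _; apply: uniq (C'P _) (proj_graph_lin a (C'P x) (C'P y)).
- move=> h Hh; apply: uniq (C'P h) _ => e e0; exists h; split => //.
    by move=> k _; rewrite subrr sip0 // expr0n; apply: mulr_ge0; [exact: ltW | exact: sip_ge0].
  by rewrite subrr sip0 // ltW.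
- by move=> x; exact: proj_graph_le.
Qed.

End ContractionExtension.
(** This is [riesz_image] for the identity on the whole space; letting [e] tend to [0] makes the
    representation exact. *)
Lemma riesz_representation (R : realType) (V : lmodType R[i]) (ip : V -> V -> R[i])
    (f : V -> R) (B : R) :
  is_hilbert ip ->
  (forall x y, f (x + y) = f x + f y) ->
  (forall (c : R) x, f ((c%:C)%C *: x) = c * f x) ->
  (forall x, 2 * f x <= rip ip x x + B) ->
  exists y, forall x, f x = rip ip y x.
Proof.
move=> hV fD fR f_le; have rP := ripP hV.1.
have [||||||y yP] := @riesz_image R V V (rip ip) ip rP hV setT id _ _ _ f B => //.
exists y => x; apply/eqP; rewrite -subr_eq0 -sqrf_eq0.
have x0 := sip_ge0 rP x; have x1 : 0 < 8 * (rip ip x x + 1) by lra.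
set D := _ ^+ 2; have : 0 <= D by exact: sqr_ge0.
rewrite le_eqVlt => /orP[/eqP <-//|D0].
(* Both errors have square at most [e * rip ip x x], so [D <= 4 * e * rip ip x x], which is less
   than [D] for this [e]. *)
have [e e0 eE] : exists2 e, 0 < e & e * (8 * (rip ip x x + 1)) = D.
  by exists (D / (8 * (rip ip x x + 1))); [exact: divr_gt0 | rewrite divfK // gt_eqF].
have [h [_ /(_ x I) hx hy]] := yP e e0.
have CS := sip_CauchySchwarz rP (y - h) x.
have : rip ip (y - h) x ^+ 2 <= e * rip ip x x.
  by apply: le_trans CS _; rewrite ler_wpM2r.
move: hx; have DE : f x - rip ip y x = (f x - rip ip h x) - rip ip (y - h) x.
  by rewrite sipB //; lra.
rewrite /D DE in D0 eE *; move: (f x - _) (rip ip (y - h) x) eE => a b eE ha hb.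
have := sqr_ge0 (a + b); have := mulr_ge0 (ltW e0) x0; lra.
Qed.

(** * Intertwining extensions *)

Section Lifting.
Variables (R : realType) (K1 K2 : lmodType R[i]).
Variables (ip1 : K1 -> K1 -> R[i]) (ip2 : K2 -> K2 -> R[i]).
Hypotheses (hK1 : is_hilbert ip1) (hK2 : is_hilbert ip2).
Local Notation r1 := (rip ip1).
Local Notation r2 := (rip ip2).
Variables (H : set K1) (A : K1 -> K1) (W V : K2 -> K2) (X : K1 -> K2) (M : R).
Hypothesis subH : subspace H.
Hypothesis A_lin : linear_on setT A.
Hypothesis A_le : forall x, r1 (A x) (A x) <= r1 x x.
Hypothesis AH : forall h, H h -> H (A h).
Hypothesis W_lin : linear_on setT W.
Hypothesis V_lin : linear_on setT V.
Hypothesis WV_adj : forall x y, r2 (W x) y = r2 x (V y).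
Hypothesis WVK : forall y, W (V y) = y.
Hypothesis X_lin : linear_on H X.
Hypothesis X_le : forall h, H h -> r2 (X h) (X h) <= M ^+ 2 * r1 h h.
Hypothesis XA : forall h, H h -> X (A h) = W (X h).

Let r1P : semi_ip r1 := ripP hK1.1.
Let r2P : semi_ip r2 := ripP hK2.1.

Definition bounded_extension (Y : K1 -> K2) : Prop :=
  [/\ linear_on setT Y, extends H Y X &
      forall x, r2 (Y x) (Y x) <= M ^+ 2 * r1 x x].

(** The defect form of [Z]; the norm bound on [Z] is its positivity. *)
Lemma semi_ip_scale_sub (c : R) (Z : K1 -> K2) : linear_on setT Z ->
  (forall x, r2 (Z x) (Z x) <= c * r1 x x) ->
  semi_ip (fun x y => c * r1 x y - r2 (Z x) (Z y)).
Proof.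
move=> Z_lin Z_le.
have Z0 : Z 0 = 0.
  by have := Z_lin 1 0 0 I I; rewrite !scale1r addr0 => /eqP; rewrite -subr_eq subrr eq_sym => /eqP.
have ZZ a x : Z (a *: x) = a *: Z x by rewrite -[a *: x]addr0 Z_lin // Z0 addr0.
split.
- move=> x y z; have -> : Z (x + y) = Z x + Z y by rewrite -[x]scale1r Z_lin // !scale1r.
  by rewrite !sipD //; lra.
- by move=> x y; rewrite (sipC r1P) (sipC r2P).
- by move=> a x y; rewrite !ZZ (sipZ r1P) (sipZ r2P).
- by move=> a x y; rewrite !ZZ (sipR r1P) (sipR r2P); lra.
- by move=> x; rewrite subr_ge0.
Qed.

Lemma bounded_extension_ex : exists Y, bounded_extension Y.
Proof.
(* The defect form of the zero map, that is, [M ^+ 2 * r1]. *)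
have qP : semi_ip (fun x y => M ^+ 2 * r1 x y - r2 0 0).
  apply: (@semi_ip_scale_sub _ (fun=> 0)) => [a x y _ _|x]; first by rewrite scaler0 addr0.
  by rewrite sip0 // mulr_ge0 ?sqr_ge0 ?(sip_ge0 r1P).
have [|Y [Y_lin YX Y_le]] := contraction_extension qP hK2 subH X_lin.
  by move=> h Hh; rewrite sip0 // subr0; exact: X_le.
by exists Y; split => // x; have := Y_le x; rewrite sip0 // subr0.
Qed.

(** [V W] is the orthogonal projection onto [ran V], and [|y|^2 - |W y|^2 = |y - V W y|^2]. *)
Lemma coisometry_le y : r2 (W y) (W y) <= r2 y y.
Proof.
have := sip_ge0 r2P (y - V (W y)).
by rewrite sip_sqrB // -!WV_adj WVK; lra.
Qed.

(* Decompose K2 = ran V + ker W: the component of the new extension in ran V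
   is forced to be V Y A, and its component in ker W extends that of X
   contractively for the form M^2 |x|^2 - |Y A x|^2. *)
Lemma bounded_extension_step Y : bounded_extension Y ->
  exists2 Y', bounded_extension Y' & forall x, W (Y' x) = Y (A x).
Proof.
move=> [Y_lin YX Y_le].
have subZ (f g : K1 -> K2) (D : set K1) : linear_on D f -> linear_on D g ->
    linear_on D (fun x => f x - g x).
  by move=> fl gl a x y Dx Dy; rewrite fl // gl // scalerBr opprD addrACA.
have WB x y : W (x - y) = W x - W y.
  by rewrite addrC -scaleN1r W_lin // scaleN1r addrC.
have YA_lin : linear_on setT (fun x => Y (A x)).
  by move=> a x y _ _; rewrite A_lin // Y_lin.
have VYA_lin : linear_on setT (fun x => V (Y (A x))).
  by move=> a x y _ _; rewrite YA_lin // V_lin.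
have YA_le x : r2 (Y (A x)) (Y (A x)) <= M ^+ 2 * r1 x x.
  by apply: le_trans (Y_le _) _; rewrite ler_wpM2l ?sqr_ge0.
have qP := semi_ip_scale_sub YA_lin YA_le.
have kerW_sqr y : r2 (y - V (W y)) (y - V (W y)) = r2 y y - r2 (W y) (W y).
  by rewrite sip_sqrB // -!WV_adj WVK; lra.
have [||C [C_lin CX C_le]] :=
    @contraction_extension R K1 K2 _ ip2 qP hK2 H (fun x => X x - V (W (X x))) subH.
- by apply: subZ => // a x y Hx Hy; rewrite X_lin // W_lin // V_lin.
(* On [H] one has [W X = X A = Y A], so the bound on [X] is exactly contractivity for the defect
   form of [Y A]. *)
- move=> h Hh; rewrite kerW_sqr YX -?XA //; last exact: AH.
  by rewrite lerD2r; exact: X_le.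
(* Off [H] the values of [C] may leave [ker W]; [1 - V W] projects them back. *)
exists (fun x => V (Y (A x)) + (C x - V (W (C x)))); last first.
  move=> x; have -> : W (V (Y (A x)) + (C x - V (W (C x)))) = Y (A x) + (W (C x) - W (C x)).
    by rewrite -{1}[V _]scale1r W_lin // scale1r WB !WVK.
  by rewrite subrr addr0.
split.
- have Cl : linear_on setT (fun x => C x - V (W (C x))).
    by apply: subZ => // a x y _ _; rewrite C_lin // W_lin // V_lin.
  move=> a x y _ _; rewrite scalerDr addrACA.
  by congr (_ + _); [exact: VYA_lin | exact: Cl].
- move=> h Hh; rewrite CX // WB WVK subrr.
  have -> : V 0 = 0 by rewrite -[0 in LHS](subrr (W 0)) addrC -scaleN1r V_lin // scaleN1r addNr.
  by rewrite subr0 YX ?XA // 1?addrC ?subrK //; exact: AH.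
- move=> x; rewrite sip_sqrD // kerW_sqr.
  have -> : r2 (V (Y (A x))) (C x - V (W (C x))) = 0.
    by rewrite sipC // -[in LHS]WV_adj WB WVK subrr sip0.
  have := C_le x; have := sip_ge0 r2P (W (C x)).
  by rewrite -WV_adj WVK; lra.
Qed.

Lemma intertwining_extension :
  exists2 Y, bounded_extension Y & forall x, Y (A x) = W (Y x).
Proof.
have [Y0 Y0P] := bounded_extension_ex.
(* The step is made total, being the identity off bounded extensions, so that it can be iterated. *)
have /boolp.choice[S SP] : forall Y, exists Y', bounded_extension Y ->
    bounded_extension Y' /\ forall x, W (Y' x) = Y (A x).
  move=> Y; have [/bounded_extension_step[Y' ? ?]|nY] := pselect (bounded_extension Y).
    by exists Y'.
  by exists Y.
pose Z n := iter n S Y0.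
have ZP n : bounded_extension (Z n) by elim: n => //= n /SP[].
have WZ n x : W (Z n.+1 x) = Z n (A x) by have [_ ->] := SP _ (ZP n).
have [L [LD LM Lshift Lle]] := banach_limit R.
have bZ y k : bounded_seq (fun n => r2 (Z n k) y).
  exists (r2 y y + M ^+ 2 * r1 k k) => n; rewrite sipC //.
  by apply: sip_norm_le => //; have [_ _] := ZP n; exact.
(* The weak limit at [k] is the Riesz representer of [x] mapped to [L (fun n => r2 (Z n k) x)]. *)
have /boolp.choice[Y YP] : forall k, exists y, forall x, L (fun n => r2 (Z n k) x) = r2 y x.
  move=> k; apply: (@riesz_representation _ _ _ _ (M ^+ 2 * r1 k k) hK2).
  - move=> x y; rewrite -LD //; congr L; apply/funext => n; exact: sipDr.
  - move=> c x; rewrite -LM //; congr L; apply/funext => n; exact: sipRr.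
  - move=> x; rewrite -ler_pdivlMl //; apply: Lle => // n; rewrite ler_pdivlMl //.
    apply: le_trans (sip_AMGM r2P _ _) _; rewrite addrC lerD2l.
    by have [_ _] := ZP n; exact.
have r2_inj y y' : (forall x, r2 y x = r2 y' x) -> y = y'.
  move=> E; apply/eqP; rewrite -subr_eq0; apply/eqP/(rip_eq0 hK2.1).
  by rewrite sipB // E subrr.
exists Y; last first.
  (* Shifting [Z n] to [Z n.+1] on the right lets [W (Z n.+1 k) = Z n (A k)] match both limits. *)
  move=> k; apply: r2_inj => x; rewrite WV_adj -!YP -[RHS]Lshift //.
  by congr L; apply/funext => n; rewrite -WV_adj WZ.
split.
- move=> a x y _ _; apply: r2_inj => z; rewrite sipD // sipZ // -!YP -LD //; congr L.
  by apply/funext => n; have [-> // _ _] := ZP n; rewrite sipD // sipZ.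
- move=> h Hh; apply: r2_inj => z; rewrite -YP.
  have -> : (fun n => r2 (Z n h) z) = (fun n => r2 (X h) z).
    by apply/funext => n; have [_ -> //] := ZP n.
  have b c : bounded_seq (fun=> c : R) by exists `|c|.
  (* [L] fixes constants: its upper bound is applied to the constant and to its negative. *)
  have := Lle _ _ (b (r2 (X h) z)) (fun=> lexx _).
  have := Lle _ _ (b (-1 * r2 (X h) z)) (fun=> lexx _).
  by rewrite (LM _ _ (b _)) => ? ?; apply/le_anti/andP; split; lra.
(* The weak limit is tested against [Y x] itself, with AM-GM applied to each [Z n x]. *)
- move=> x; have : r2 (Y x) (Y x) * 2 <= r2 (Y x) (Y x) + M ^+ 2 * r1 x x; last by lra.
  rewrite -{1}YP -ler_pdivlMr //; apply: Lle => // n; rewrite ler_pdivlMr // mulrC.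
  apply: le_trans (sip_AMGM r2P _ _) _; rewrite addrC lerD2l.
  by have [_ _] := ZP n; exact.
Qed.

End Lifting.

(** * Operator norms and projections *)

Section OperatorNorm.
Variables (R : realType) (K1 K2 : lmodType R[i]).
Variables (ip1 : K1 -> K1 -> R[i]) (ip2 : K2 -> K2 -> R[i]).
Hypotheses (ip1P : is_inner_product ip1) (ip2P : is_inner_product ip2).

Lemma hnorm_scale (V : lmodType R[i]) (ip : V -> V -> R[i]) (t : R) (x : V) :
  is_inner_product ip -> 0 <= t -> hnorm ip ((t%:C)%C *: x) = t * hnorm ip x.
Proof.
move=> ipP t0; have rP := ripP ipP; rewrite /hnorm -/(rip ip _ _) -/(rip ip _ _).
by rewrite sipR // sipRr // mulrA -expr2 sqrtrM ?sqr_ge0 // sqrtr_sqr ger0_norm.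
Qed.

Lemma hnorm0 (V : lmodType R[i]) (ip : V -> V -> R[i]) :
  is_inner_product ip -> hnorm ip 0 = 0.
Proof.
by move=> ipP; rewrite -[0 in LHS](scale0r 0) (hnorm_scale _ ipP (lexx 0)) mul0r.
Qed.

Section Bound.
Variables (H : set K1) (X : K1 -> K2).
Hypotheses (subH : subspace H) (X_lin : linear_on H X) (X_bnd : bounded_on ip1 ip2 H X).

Lemma opnorm_has_sup :
  has_sup [set hnorm ip2 (X x) | x in [set x | H x /\ hnorm ip1 x <= 1]].
Proof.
split; first by exists (hnorm ip2 (X 0)), 0 => //; rewrite /= hnorm0 //; split; [exact: subH.1|].
(* The bound [B] may be negative when [H] is trivial. *)
have [B XB] := X_bnd; exists `|B| => _ [x [Hx x1] <-].
apply: le_trans (XB x Hx) _; apply: le_trans (ler_norm _) _.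
by rewrite normrM (ger0_norm (hnorm_ge0 _ _)) ler_piMr.
Qed.

Lemma opnorm_ge0 : 0 <= opnorm ip1 ip2 H X.
Proof.
apply: le_trans (hnorm_ge0 ip2 (X 0)) (sup_upper_bound opnorm_has_sup _).
by exists 0 => //; rewrite /= hnorm0 //; split; [exact: subH.1|].
Qed.

Lemma opnorm_le h : H h -> hnorm ip2 (X h) <= opnorm ip1 ip2 H X * hnorm ip1 h.
Proof.
move=> Hh; have := hnorm_ge0 ip1 h; rewrite le_eqVlt => /orP[/eqP h0|h0].
  (* A vector of norm zero cannot be normalised; any bound [B] gives [X h] norm zero. *)
  have [B /(_ h Hh)] := X_bnd; by rewrite -h0 !mulr0.
have t0 : 0 <= (hnorm ip1 h)^-1 by rewrite invr_ge0 ltW.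
pose x := (((hnorm ip1 h)^-1)%:C)%C *: h.
have X0 : X 0 = 0.
  by rewrite -[0 in LHS](addNr 0) -scaleN1r X_lin ?scaleN1r ?addNr //; exact: subH.1.
have Xx : X x = (((hnorm ip1 h)^-1)%:C)%C *: X h.
  by rewrite /x -[_ *: h]addr0 X_lin ?X0 ?addr0 //; exact: subH.1.
have Hx : H x by rewrite /x -[_ *: h]addr0; apply: subH.2 => //; exact: subH.1.
rewrite -ler_pdivrMr // mulrC -hnorm_scale // -Xx.
apply: (sup_upper_bound opnorm_has_sup); exists x => //; split => //=.
by rewrite hnorm_scale // mulVf // gt_eqF.
Qed.

End Bound.

Lemma opnorm_eq (H : set K1) (X Y : K1 -> K2) :
  subspace H -> bounded_on ip1 ip2 H X -> extends H Y X ->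
  (forall x, hnorm ip2 (Y x) <= opnorm ip1 ip2 H X * hnorm ip1 x) ->
  opnorm ip1 ip2 setT Y = opnorm ip1 ip2 H X.
Proof.
move=> subH X_bnd YX Y_le; have M0 := opnorm_ge0 subH X_bnd.
have nonempty (D : set K1) Z : D 0 ->
    [set hnorm ip2 (Z x) | x in [set x | D x /\ hnorm ip1 x <= 1]] !=set0.
  by move=> D0; exists (hnorm ip2 (Z 0)), 0 => //; rewrite /= hnorm0.
have Y_ub : ubound [set hnorm ip2 (Y x) | x in [set x | setT x /\ hnorm ip1 x <= 1]]
    (opnorm ip1 ip2 H X).
  by move=> _ [x [_ x1] <-]; apply: le_trans (Y_le x) _; rewrite ler_piMr.
apply/le_anti/andP; split; apply: ge_sup => //; try exact: nonempty.
  by apply: nonempty; exact: subH.1.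
move=> _ [x [Hx x1] <-]; rewrite -YX //.
apply: sup_upper_bound; last by exists x.
by split; [exact: nonempty | exists (opnorm ip1 ip2 H X)].
Qed.

End OperatorNorm.

(** [x] itself shows that [xget] finds a projection [p]; then [x - p] lies in [H] and is orthogonal
    to [H]. *)
Lemma proj_id (R : realType) (V : lmodType R[i]) (ip : V -> V -> R[i]) (H : set V) x :
  is_inner_product ip -> subspace H -> H x -> proj ip H x = x.
Proof.
move=> ipP [H0 HD] Hx; have rP := ripP ipP; rewrite /proj.
have [Hp xp] : [set p | is_orth_proj ip H x p] (xget 0 [set p | is_orth_proj ip H x p]).
  apply: xgetPex; exists x; split => // h Hh; rewrite subrr.
  have [ipL _ _ _] := ipP.
  by rewrite -[0](addNr 0) -scaleN1r ipL mulN1r addNr.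
move: Hp xp; set p := xget _ _ => Hp xp.
apply/esym/eqP; rewrite -subr_eq0; apply/eqP/(rip_eq0 ipP).
by rewrite /rip xp // addrC -scaleN1r; exact: HD.
Qed.

(** * Commutant lifting *)

Section CommutantLifting.
Variables (R : realType) (K1 K2 : lmodType R[i]).
Variables (ip1 : K1 -> K1 -> R[i]) (ip2 : K2 -> K2 -> R[i]).
Hypotheses (hK1 : is_hilbert ip1) (hK2 : is_hilbert ip2).
Variables (H1 : set K1) (H2 : set K2).
Hypotheses (hH1 : closed_subspace ip1 H1) (hH2 : closed_subspace ip2 H2).
Variables (T1 W1 : K1 -> K1) (T2 W2 : K2 -> K2).
Hypotheses (T1H : maps_into H1 H1 T1) (T2H : maps_into H2 H2 T2).
Hypotheses (W1T1 : extends H1 W1 T1) (W2T2 : extends H2 W2 T2).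
Variable X : K1 -> K2.
Hypothesis hX : bop_on ip1 ip2 H1 H2 X.

Let subH1 : subspace H1. Proof. by case: hH1. Qed.
Let subH2 : subspace H2. Proof. by case: hH2. Qed.

Lemma iter_extends (V : lmodType R[i]) (H : set V) (T W : V -> V) n h :
  maps_into H H T -> extends H W T -> H h ->
  H (iter n T h) /\ iter n W h = iter n T h.
Proof. by move=> TH WT Hh; elim: n => //= n [Hn ->]; split; [exact: TH | exact: WT]. Qed.

(** Iterates of [W1] and [W2] started in [H1] and [H2] stay there and agree with those of [T1] and
    [T2], so the power identities only project vectors of [H2]. *)
Lemma bounded_extension_good Y :
  bounded_extension ip1 ip2 H1 X (opnorm ip1 ip2 H1 X) Y ->
  good_extension ip1 ip2 H1 H2 T1 W1 T2 W2 X Y.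
Proof.
move=> [Y_lin YX Y_le]; have [XH X_lin X_bnd] := hX.
have Y_bnd x : hnorm ip2 (Y x) <= opnorm ip1 ip2 H1 X * hnorm ip1 x.
  rewrite (hnorm_le_rip _ _ hK2.1 hK1.1); first exact: Y_le.
  exact (opnorm_ge0 hK1.1 subH1 X_bnd).
split => //.
- by split => //; exists (opnorm ip1 ip2 H1 X) => x _.
- move=> n h Hh; rewrite YX //; have [Hn ->] := iter_extends n T2H W2T2 (XH h Hh).
  by rewrite proj_id //; exact: hK2.1.
- move=> n h Hh; have [Hn ->] := iter_extends n T1H W1T1 Hh.
  by rewrite YX // proj_id //; [exact: hK2.1 | exact: XH].
- exact (opnorm_eq hK1.1 subH1 X_bnd YX Y_bnd).
Qed.

(** [A] and [W] are separate from [W1] and [W2]: the intertwining involves products with [Qb], the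
    power identities do not. *)
Lemma commutant_lifting (A : K1 -> K1) (W V : K2 -> K2) :
  linear_on setT A -> (forall x, rip ip1 (A x) (A x) <= rip ip1 x x) ->
  maps_into H1 H1 A ->
  linear_on setT W -> linear_on setT V ->
  (forall x y, rip ip2 (W x) y = rip ip2 x (V y)) -> (forall y, W (V y) = y) ->
  (forall h, H1 h -> X (A h) = W (X h)) ->
  exists Y, good_extension ip1 ip2 H1 H2 T1 W1 T2 W2 X Y /\ forall k, Y (A k) = W (Y k).
Proof.
move=> A_lin A_le AH W_lin V_lin WV_adj WVK XA; have [XH X_lin X_bnd] := hX.
have X_le h : H1 h ->
    rip ip2 (X h) (X h) <= opnorm ip1 ip2 H1 X ^+ 2 * rip ip1 h h.
  move=> Hh; rewrite -[rip ip1 h h]/(complex.Re (ip1 h h)).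
  rewrite -(hnorm_le_rip _ _ hK2.1 hK1.1); last exact (opnorm_ge0 hK1.1 subH1 X_bnd).
  exact (opnorm_le hK1.1 hK2.1 subH1 X_lin X_bnd Hh).
have [Y YP YA] := intertwining_extension hK1 hK2 subH1 A_lin A_le AH W_lin V_lin
  WV_adj WVK X_lin X_le XA.
by exists Y; split => //; exact: bounded_extension_good.
Qed.

End CommutantLifting.

Lemma contraction_rip (R : realType) (K : lmodType R[i]) (ip : K -> K -> R[i])
    (Q : K -> K) :
  is_inner_product ip -> contraction_on ip setT Q ->
  forall x, rip ip (Q x) (Q x) <= rip ip x x.
Proof.
move=> ipP [_ Q_le] x; have := Q_le x I.
by rewrite -[hnorm ip x]mul1r hnorm_le_rip // expr1n mul1r.
Qed.

Lemma rip_adjoint (R : realType) (K : lmodType R[i]) (ip : K -> K -> R[i])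
    (W Ws : K -> K) :
  adjoint_on ip ip setT setT W Ws -> forall x y, rip ip (W x) y = rip ip x (Ws y).
Proof. by move=> [_ adj] x y; rewrite /rip adj. Qed.

Theorem mainTheorem6 (R : realType)
  (K1 K2 : lmodType R[i]) (ip1 : K1 -> K1 -> R[i]) (ip2 : K2 -> K2 -> R[i])
  (hK1 : is_hilbert ip1) (hK2 : is_hilbert ip2)
  (H1 : set K1) (H2 : set K2)
  (hH1 : closed_subspace ip1 H1) (hH2 : closed_subspace ip2 H2)
  (T1 W1 : K1 -> K1) (T2 W2 : K2 -> K2)
  (hT1 : contraction_on ip1 H1 T1) (hT2 : contraction_on ip2 H2 T2)
  (hW1 : coisometry ip1 W1) (hW2 : coisometry ip2 W2)
  (hW1T1 : extends H1 W1 T1) (hW2T2 : extends H2 W2 T2)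
  (X : K1 -> K2) (hX : bop_on ip1 ip2 H1 H2 X) :
  (forall Q Qb : K1 -> K1,
     contraction_on ip1 H1 Q -> contraction_on ip1 setT Qb ->
     reduces ip1 H1 Qb -> extends H1 Qb Q ->
     ((forall h, H1 h -> X (T1 (Q h)) = T2 (X h)) ->
        exists Y : K1 -> K2,
          good_extension ip1 ip2 H1 H2 T1 W1 T2 W2 X Y /\
          forall k, Y (W1 (Qb k)) = W2 (Y k)) /\
     ((forall h, H1 h -> X (Q (T1 h)) = T2 (X h)) ->
        exists Y : K1 -> K2,
          good_extension ip1 ip2 H1 H2 T1 W1 T2 W2 X Y /\
          forall k, Y (Qb (W1 k)) = W2 (Y k))) /\
  (forall Q Qb : K2 -> K2,
     unitary_on ip2 H2 Q -> unitary_on ip2 setT Qb ->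
     reduces ip2 H2 Qb -> extends H2 Qb Q ->
     (forall h, H1 h -> Q (X (T1 h)) = T2 (X h)) ->
        exists Y : K1 -> K2,
          good_extension ip1 ip2 H1 H2 T1 W1 T2 W2 X Y /\
          forall k, Qb (Y (W1 k)) = W2 (Y k)).
Proof.
have [T1H _ _] := hT1.1; have [T2H _ _] := hT2.1.
have [[_ W1_lin _] [W1s [_ [/rip_adjoint W1adj W1K]]]] := hW1.
have [[_ W2_lin _] [W2s [[_ W2s_lin _] [/rip_adjoint W2adj W2K]]]] := hW2.
have W1_le := coisometry_le hK1 W1adj W1K.
have [XH _ _] := hX.
have lift := commutant_lifting hK1 hK2 hH1 hH2 T1H T2H hW1T1 hW2T2 hX.
split=> Q Qb.
  move=> [[QH _ _] _] hQb _ QbQ; have [[_ Qb_lin _] _] := hQb.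
  have Qb_le := contraction_rip hK1.1 hQb.
  split=> XT.
  - apply: (lift (fun k => W1 (Qb k)) W2 W2s) => //.
    + by move=> a x y _ _; rewrite Qb_lin // W1_lin.
    + by move=> x; exact: le_trans (W1_le _) (Qb_le _).
    + by move=> h Hh; rewrite QbQ // hW1T1; [apply: T1H |]; exact: QH.
    + move=> h Hh; rewrite QbQ // hW1T1; last exact: QH.
      by rewrite XT // hW2T2 //; exact: XH.
  - apply: (lift (fun k => Qb (W1 k)) W2 W2s) => //.
    + by move=> a x y _ _; rewrite W1_lin // Qb_lin.
    + by move=> x; exact: le_trans (Qb_le _) (W1_le _).
    + by move=> h Hh; rewrite hW1T1 // QbQ; [apply: QH |]; exact: T1H.
    + move=> h Hh; rewrite hW1T1 // QbQ; last exact: T1H.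
      by rewrite XT // hW2T2 //; exact: XH.
move=> _ [[_ Qb_lin _] [Qs [[_ Qs_lin _] [/rip_adjoint Qadj [QsK QK]]]]] _ QbQ XT.
have r2P := ripP hK2.1.
(* Multiplying by [Qs], the inverse of [Qb], turns the goal into [Y W1 = Qs W2 Y]; [Qs W2] is a
   co-isometry with adjoint [W2s Qb]. *)
have [||||||||Y [Yg YW]] := lift W1 (fun k => Qs (W2 k)) (fun k => W2s (Qb k)) => //.
- by move=> h Hh; rewrite hW1T1 //; exact: T1H.
- by move=> a x y _ _; rewrite W2_lin // Qs_lin.
- by move=> a x y _ _; rewrite Qb_lin // W2s_lin.
- by move=> x y; rewrite -W2adj [LHS]sipC // -Qadj sipC.
- by move=> y; rewrite W2K QK.
- move=> h Hh; rewrite hW1T1 // hW2T2; last exact: XH.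
  by rewrite -XT // -QbQ ?QK //; exact/XH/T1H.
by exists Y; split => // k; rewrite YW QsK.
Qed.
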